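(* Suppose $(a,\mathbf{b})$ is a characteristic point of the well-conditioned system $\mathbf{y}=\mathbf{G}(x,\mathbf{y})$, and let $(\rho,\boldsymbol{\tau})$ be the extreme point of the system. Then $\Lambda(a,\mathbf{b})=1$ if and only if $(a,\mathbf{b})=(\rho,\boldsymbol{\tau})$.
   Context: Let $m\ge 1$ and $\mathbf{y}=(y_1,\dots,y_m)$. A system $\mathbf{y}=\mathbf{G}(x,\mathbf{y})$ means $y_i=G_i(x,y_1,\dots,y_m)$, $1\le i\le m$, where the $G_i$ are power series; its Jacobian matrix is $J_{\mathbf{G}}(x,\mathbf{y})=\big(\partial G_i/\partial y_j\big)_{1\le i,j\le m}$ (no derivative in $x$). The system is well-conditioned if: (a) each $G_i(x,\mathbf{y})$ is a power series with nonnegative real coefficients; (b) $\mathbf{G}$ is holomorphic in a neighborhood of the origin; (c) $\mathbf{G}(0,\mathbf{y})=\mathbf{0}$; (d) $G_i(x,\mathbf{0})\ne 0$ for all $i$; (e) the system is irreducible, i.e. the nonnegative matrix of power series $J_{\mathbf{G}}$ is irreducible (the directed graph on $\{1,\dots,m\}$ with an edge $i\to j$ whenever $\partial G_i/\partial y_j\neq 0$ is strongly connected); (f) $\partial^2 G_i/\partial y_j\partial y_k\ne 0$ for some $i,j,k$. For a well-conditioned system there is a unique vector $\mathbf{T}(x)=(T_1(x),\dots,T_m(x))$ of formal power series with nonnegative coefficients such that $\mathbf{T}(x)=\mathbf{G}(x,\mathbf{T}(x))$ formally (it satisfies $\mathbf{T}(0)=\mathbf{0}$); it is called the standard solution. It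 is a standard fact that all $T_i$ have the same radius of convergence $\rho\in(0,\infty)$ and that $\tau_i:=T_i(\rho)<\infty$. With $\boldsymbol{\tau}=(\tau_1,\dots,\tau_m)$, the point $(\rho,\boldsymbol{\tau})$ is the extreme point of the system. A characteristic point of the system is a point $(a,\mathbf{b})\in\mathbb{R}^{m+1}$ with all coordinates positive that solves the characteristic system $\mathbf{y}=\mathbf{G}(x,\mathbf{y})$, $\det\big(I-J_{\mathbf{G}}(x,\mathbf{y})\big)=0$ (in particular the series $G_i$ and $\partial G_i/\partial y_j$ converge at $(a,\mathbf{b})$). $\Lambda(a,\mathbf{b})$ denotes the largest real eigenvalue of the nonnegative matrix $J_{\mathbf{G}}(a,\mathbf{b})$, equivalently its spectral radius. *)

(* Defs.v *)
From mathcomp Require Import all_boot all_order all_algebra.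
From mathcomp Require Import all_classical all_reals all_analysis.
From mathcomp Require Import complex.

Set Implicit Arguments.
Unset Strict Implicit.
Unset Printing Implicit Defensive.

Import Order.TTheory GRing.Theory Num.Theory.
Import numFieldNormedType.Exports.

Local Open Scope classical_set_scope.
Local Open Scope ring_scope.

(* (n, k) stands for the monomial x^n * \prod_j y_j^(k j). *)
Notation midx m := (nat * {ffun 'I_m -> nat})%type.

(* A formal power series in x, y_1, ..., y_m, given by its coefficients. *)
Definition mvfps (S : Type) (m : nat) := midx m -> S.

Section Series.
Variables (R : realType) (m : nat).
Implicit Types (c : mvfps R m) (G : 'I_m -> mvfps R m).
Implicit Types (T : 'I_m -> nat -> R).

Definition mvfps_neq0 c : Prop := exists p, c p != 0.

Definition mvfps_dy (j : 'I_m) c : mvfps R m := fun p =>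
  (p.2 j).+1%:R * c (p.1, [ffun l => (p.2 l + (l == j))%N]).

Definition mvfps_term (S : comNzRingType) (c : mvfps S m) (x : S) (y : 'rV[S]_m)
    (p : midx m) : S :=
  c p * x ^+ p.1 * \prod_(j < m) y 0 j ^+ p.2 j.

Definition mvfps_converges c (x : R) (y : 'rV[R]_m) : Prop :=
  summable [set: midx m] (fun p => (mvfps_term c x y p)%:E).

(* Meaningful where the series converges and its terms are nonnegative (\esum
   is a sum of nonnegative terms); it is only used for nonnegative
   coefficients at positive points. *)
Definition mvfps_eval c (x : R) (y : 'rV[R]_m) : R :=
  fine (\esum_(p in [set: midx m]) (mvfps_term c x y p)%:E)%E.

(* Absolute convergence on a complex polydisc centred at the origin. *)
Definition mvfps_holomorphic_near0 c : Prop :=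
  exists2 r : R, 0 < r &
    forall (z : R[i]) (w : 'rV[R[i]]_m),
      ComplexField.Normc.normc z < r ->
      (forall j, ComplexField.Normc.normc (w 0 j) < r) ->
      summable [set: midx m]
        (fun p => (ComplexField.Normc.normc
                     (mvfps_term (fun q => (c q)%:C%C) z w p))%:E).

Definition jacobian_graph G : rel 'I_m :=
  fun i j => `[< mvfps_neq0 (mvfps_dy j (G i)) >].

Definition irreducible_system G : Prop :=
  forall i j, connect (jacobian_graph G) i j.

Definition jacobian_at G (x : R) (y : 'rV[R]_m) : 'M[R]_m :=
  \matrix_(i, j) mvfps_eval (mvfps_dy j (G i)) x y.

Record well_conditioned G : Prop := WellConditioned {
  wc_ge0 : forall i p, 0 <= G i p;
  wc_holo : forall i, mvfps_holomorphic_near0 (G i);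
  wc_x0 : forall i k, G i (0%N, k) = 0;
  wc_y0 : forall i, exists n, G i (n, [ffun=> 0%N]) != 0;
  wc_irr : irreducible_system G;
  wc_nonlinear : exists i j k, mvfps_neq0 (mvfps_dy j (mvfps_dy k (G i)))
}.

(* The coefficient of x^N in c(x, T(x)), when all T_j have zero constant term:
   then T_j matters only up to x^N, and the monomial (n, k) contributes
   only if n <= N and all k_j <= N. *)
Definition mvfps_subst c T (N : nat) : R :=
  \sum_(n < N.+1) \sum_(k : {ffun 'I_m -> 'I_N.+1})
    c (n : nat, [ffun j => k j : nat]) *
    ('X^n * \prod_(j < m) (\poly_(l < N.+1) T j l) ^+ k j)`_N.

Record standard_solution G T : Prop := StandardSolution {
  ss_ge0 : forall i n, 0 <= T i n;
  ss_at0 : forall i, T i 0%N = 0;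
  ss_fix : forall i n, T i n = mvfps_subst (G i) T n
}.

Definition radius_of_convergence (u : nat -> R) : \bar R :=
  ereal_sup [set r%:E | r in [set r : R | 0 <= r /\ cvgn (pseries u r)]].

Definition extreme_point G (rho : R) (tau : 'rV[R]_m) : Prop :=
  exists T, standard_solution G T /\
    forall i, radius_of_convergence (T i) = rho%:E /\
              pseries (T i) rho @ \oo --> tau 0 i.

Record characteristic_point G (a : R) (b : 'rV[R]_m) : Prop :=
  CharacteristicPoint {
  cp_a_gt0 : 0 < a;
  cp_b_gt0 : forall i, 0 < b 0 i;
  cp_cvg : forall i, mvfps_converges (G i) a b;
  cp_dy_cvg : forall i j, mvfps_converges (mvfps_dy j (G i)) a b;
  cp_fix : forall i, b 0 i = mvfps_eval (G i) a b;
  cp_det : \det (1%:M - jacobian_at G a b) = 0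
}.

(* The set is finite, and it is nonempty when A has nonnegative entries and
   m > 0, so the supremum is then a maximum. *)
Definition largest_eigenvalue (A : 'M[R]_m) : R :=
  sup [set l : R | eigenvalue A l].

Definition Lambda G (a : R) (b : 'rV[R]_m) : R :=
  largest_eigenvalue (jacobian_at G a b).

End Series.

(* Main.v *)
(** Writing J = J_G(a, b), nonnegativity and irreducibility give, by
    Perron-Frobenius (maximize l subject to u A >= l u over the simplex), a
    vector u > 0 with u J = l u where l >= 1 is real.

    If Lambda(a, b) = 1 then l = 1.  The partial sums of T(a) stay below b, so
    t = T(a) exists, t <= b, and G(a, t) <= t.  For d = b - t, the tangent
    inequality at b gives d <= J d; pairing with u forces d = J d, hence
    d = 0 or d > 0, and in the latter case a nonlinear monomial makes the
    tangent inequality strict somewhere, a contradiction.  So T(a) = b and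
    a <= rho; if a < rho, then v = tau - b >= 0 satisfies J v < v in every
    coordinate by the tangent inequality at (a, b), contradicting u J = u.

    Conversely let (a, b) = (rho, tau) and let y_n be the n-th partial sum of
    T(rho).  Then y_n <= G(rho, y_n), so v_n = tau - y_n satisfies
    J_G(rho, y_n) v_n <= v_n, and v_n > 0 because rho is finite.  As
    u J_G(rho, y_n) tends to l u, l > 1 is impossible. *)
Require Import Defs.
From mathcomp Require Import all_boot all_order all_algebra.
From mathcomp Require Import all_classical all_reals all_analysis.
From mathcomp Require Import lra.
Import Order.TTheory GRing.Theory Num.Theory.
Import numFieldNormedType.Exports.

Set Implicit Arguments.
Unset Strict Implicit.
Unset Printing Implicit Defensive.

Local Open Scope classical_set_scope.
Local Open Scope ring_scope.

(** * Perron-Frobenius *)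

(** Carries positivity, or vanishing, of one coordinate to all coordinates of an irreducible
    matrix. *)
Lemma connect_invariant (T : finType) (e : rel T) (P : T -> Prop) :
  (forall x y, e x y -> P x -> P y) -> forall x y, connect e x y -> P x -> P y.
Proof.
move=> eP x y /connectP[p]; elim: p x => [|z p IHp] x /=; first by move=> _ ->.
by case/andP=> exz pz lasty Px; apply: (IHp z) => //; apply: eP exz Px.
Qed.

Section Perron.
Variables (R : realType) (m : nat) (A : 'M[R]_m).
Hypothesis A_ge0 : forall i j, 0 <= A i j.
Hypothesis A_irr : forall i j, connect (fun i j => 0 < A i j) i j.
Implicit Types (u v z : 'rV[R]_m) (l : R).

Lemma mulmx_rowE u j : (u *m A) 0 j = \sum_i u 0 i * A i j.
Proof. by rewrite mxE. Qed.

Lemma row_neq0P u : (forall i, 0 <= u 0 i) -> u != 0 -> exists i, 0 < u 0 i.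
Proof.
move=> u0; apply: contra_neqP => /forallNP uN; apply/rowP => i; rewrite mxE.
by apply/eqP; rewrite eq_le u0 andbT leNgt; apply/negP/uN.
Qed.

(** Multiplication by [I + A]. The identity summand makes the iterates of a nonnegative row
    nondecreasing, so a coordinate stays positive once it is positive, and irreducibility alone
    makes some power positive. *)
Let step v := v + v *m A.

Let step_ge v : (forall i, 0 <= v 0 i) -> forall i, v 0 i <= step v 0 i.
Proof.
move=> v0 i; rewrite /step mxE lerDl mulmx_rowE.
by apply: sumr_ge0 => k _; rewrite mulr_ge0.
Qed.

Let iter_step_ge0 v n : (forall i, 0 <= v 0 i) ->
  forall i, 0 <= iter n step v 0 i.
Proof.
move=> v0; elim: n => [//|n IHn] i /=.
by apply: le_trans (step_ge IHn i); apply: IHn.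
Qed.

Let iter_step_mono v n k : (forall i, 0 <= v 0 i) -> (n <= k)%N ->
  forall i, iter n step v 0 i <= iter k step v 0 i.
Proof.
move=> v0 /subnKC <- i; elim: (k - n)%N => [|d IHd]; first by rewrite addn0.
by rewrite addnS /=; apply: le_trans IHd _; apply/step_ge/iter_step_ge0.
Qed.

Let iter_step_gt0 z : (forall i, 0 <= z 0 i) -> z != 0 ->
  exists n, forall j, 0 < iter n step z 0 j.
Proof.
move=> z0 /(row_neq0P z0)[i0 zi0].
have /choice[f fP] j : exists n, 0 < iter n step z 0 j.
  apply: (connect_invariant (P := fun j => exists n, 0 < iter n step z 0 j) _
    (A_irr i0 j)); last by exists 0%N.
  move=> i k Aik [n ni]; exists n.+1 => /=; rewrite /step mxE mulmx_rowE.
  rewrite ltr_wpDl ?iter_step_ge0//.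
  rewrite (bigD1 i)//= ltr_wpDr ?mulr_gt0// sumr_ge0// => l _.
  by rewrite mulr_ge0 ?iter_step_ge0.
(* Monotonicity of the iterates lets the largest of the exponents serve every coordinate. *)
exists (\max_j f j)%N => j; apply: lt_le_trans (fP j) _.
by apply: iter_step_mono => //; apply: leq_bigmax.
Qed.

(** Powers of [I + A] commute with [A], so iterating the defect [u A - l u] gives the defect of the
    iterated row. *)
Let iter_stepB u l n :
  iter n step (u *m A - l *: u) = iter n step u *m A - l *: iter n step u.
Proof.
elim: n => [//|n IHn] /=; rewrite IHn /step mulmxBl mulmxDl scalerDr -scalemxAl.
by rewrite opprD addrACA.
Qed.

(** The defect [u A - l u] is nonnegative and nonzero. A power of [I + A] makes it positive in every
    coordinate, which leaves room to increase [l]. *)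
Lemma subeigenvector_improve u l : 0 <= l -> (forall i, 0 <= u 0 i) ->
  (forall j, l * u 0 j <= (u *m A) 0 j) -> u *m A != l *: u ->
  exists l' v, [/\ l < l', (forall i, 0 <= v 0 i), v != 0 &
    forall j, l' * v 0 j <= (v *m A) 0 j].
Proof.
move=> l0 u0 ul uN; pose z := u *m A - l *: u.
have z0 i : 0 <= z 0 i by rewrite /z !mxE subr_ge0 -mulmx_rowE.
have zN : z != 0 by rewrite subr_eq0.
have [n nz] := iter_step_gt0 z0 zN.
pose v := iter n step u.
have v0 i : 0 <= v 0 i by apply: iter_step_ge0.
have vE j : l * v 0 j < (v *m A) 0 j.
  by have := nz j; rewrite /z iter_stepB !mxE subr_gt0.
(* The slack is divided by [1 + v 0 j], not by [v 0 j], which is only known to be nonnegative at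
   this point. *)
pose e := \big[Num.min/1]_j (((v *m A) 0 j - l * v 0 j) / (1 + v 0 j)).
have v1 j : 0 < 1 + v 0 j by rewrite ltr_pwDl.
have e0 : 0 < e.
  apply/bigmin_gtP; split=> // j _.
  by rewrite divr_gt0 ?subr_gt0.
have vN : v != 0.
  apply: contraTneq isT => ve.
  have /(row_neq0P u0)[i _] : u != 0.
    by apply: contra_neq uN => ->; rewrite mul0mx scaler0.
  by have := vE i; rewrite ve mul0mx !mxE mulr0 ltxx.
exists (l + e), v; split=> //; first by rewrite ltrDl.
move=> j; rewrite mulrDl -lerBrDl.
have : e <= ((v *m A) 0 j - l * v 0 j) / (1 + v 0 j) by apply: bigmin_le_cond.
rewrite ler_pdivlMr//; apply: le_trans; rewrite ler_wpM2l ?(ltW e0)//.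
by rewrite lerDr.
Qed.

Local Notation RV := (R * 'rV[R]_m)%type.

(* The Collatz-Wielandt problem: a maximizer of p.1 is an eigenpair. *)
Definition subeigen : set RV :=
  [set p : RV | [/\ 0 <= p.1, (forall i, 0 <= p.2 0 i <= 1),
    \sum_i p.2 0 i = 1 &
    forall j, p.1 * p.2 0 j <= (p.2 *m A) 0 j]].

Lemma subeigen_normalize l v : 0 <= l -> (forall i, 0 <= v 0 i) -> v != 0 ->
  (forall j, l * v 0 j <= (v *m A) 0 j) -> exists w, subeigen (l, w).
Proof.
move=> l0 v0 vN vl; have [i vi] := row_neq0P v0 vN.
have vs j : v 0 j <= \sum_i v 0 i by rewrite (bigD1 j)//= lerDl sumr_ge0.
have s0 := lt_le_trans vi (vs i).
exists ((\sum_i v 0 i)^-1 *: v); split => //=.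
- move=> j; rewrite mxE mulr_ge0 ?invr_ge0 ?(ltW s0)//=.
  by rewrite mulrC ler_pdivrMr// mul1r.
- under eq_bigr do rewrite mxE.
  by rewrite -mulr_sumr mulVf// gt_eqF.
- move=> j; rewrite -scalemxAl !mxE mulrCA -mulmx_rowE.
  by rewrite ler_wpM2l ?invr_ge0 ?(ltW s0).
Qed.

(** Sum the inequalities [l v_j <= (v A)_j] over [j]: the entries of [v] are at most 1 and add up to
    1. This bounds the first component, as compactness requires. *)
Lemma subeigen_le l v : subeigen (l, v) -> l <= \sum_j \sum_i A i j.
Proof.
case=> /= l0 v1 vs vl; rewrite -[l]mulr1 -vs mulr_sumr ler_sum// => j _.
apply: le_trans (vl j) _; rewrite mulmx_rowE ler_sum// => i _.
by case/andP: (v1 i) => *; rewrite ler_piMl.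
Qed.

Lemma subeigen_compact : compact subeigen.
Proof.
have cK : compact (`[0, \sum_j \sum_i A i j]%classic `*`
    [set v : 'rV[R]_m | forall i, `[0 : R, 1]%classic (v ord0 i)]).
  apply: compact_setX; first exact: segment_compact.
  by apply: (@rV_compact _ _ (fun=> `[0 : R, 1]%classic)) => i;
    exact: segment_compact.
apply: subclosed_compact cK _; last first.
  move=> [l v] lv; have := subeigen_le lv; case: lv => /= l0 v1 _ _ lM.
  by split => /= [|i]; rewrite in_itv/= ?l0.
have c2 i : continuous (fun p : RV => p.2 0 i).
  move=> p; apply: (continuous_comp (g := fun v : 'rV[R]_m => v 0 i)).
    exact: cvg_snd.
  exact: coord_continuous.
have c1 : continuous (fun p : RV => p.1) by move=> p; exact: cvg_fst.
have cle (f g : RV -> R) : continuous f -> continuous g ->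
    closed [set p : RV | f p <= g p].
  move=> cf cg; rewrite (_ : [set p : RV | _] =
      (g \- f) @^-1` [set x | 0 <= x]).
    apply: closed_comp => // p _; apply: cvgB; [exact: cg|exact: cf].
  by apply/seteqP; split=> p /=; rewrite subr_ge0.
have csum (h : 'I_m -> RV -> R) : (forall i, continuous (h i)) ->
    continuous (fun p => \sum_i h i p).
  by move=> ch p; apply: cvg_big => [|i _]; [exact: add_continuous|exact: ch].
(* Every condition becomes a weak inequality between continuous functions; the equation for the sum
   is split into two of them. *)
rewrite (_ : subeigen = [set p : RV | 0 <= p.1] `&`
   \bigcap_(i in [set: 'I_m]) [set p : RV | 0 <= p.2 0 i] `&`
   \bigcap_(i in [set: 'I_m]) [set p : RV | p.2 0 i <= 1] `&`
   [set p : RV | \sum_i p.2 0 i <= 1] `&` [set p : RV | 1 <= \sum_i p.2 0 i] `&`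
   \bigcap_(j in [set: 'I_m]) [set p : RV | p.1 * p.2 0 j <= \sum_i p.2 0 i * A i j]).
  have ccst (x : R) : continuous (fun _ : RV => x).
    by move=> p; exact: cvg_cst.
  repeat apply: closedI; try apply: closed_bigI => i _; apply: cle => //.
  - exact: csum.
  - exact: csum.
  - by move=> p; apply: cvgM; [exact: c1|exact: c2].
  - by apply: csum => k p; apply: cvgM; [exact: c2|exact: cvg_cst].
apply/seteqP; split=> [[l v] /= [l0 v1 vs vl]|
    [l v] /= [[[[[l0 v0] v1] s1] s2] vl]].
  rewrite vs !lexx; (do !split) => // i _ /=; try by case/andP: (v1 i).
  by rewrite -mulmx_rowE.
split => //=.
- by move=> i; rewrite v0//=; exact: v1.
- by apply/eqP; rewrite eq_le s1.
- by move=> j; rewrite mulmx_rowE; exact: vl.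
Qed.

(** If [u_i > 0] and [A_ik > 0], then [l u_k = (u A)_k > 0], so [u_k] cannot vanish. *)
Lemma eigenvector_gt0 l u : (forall i, 0 <= u 0 i) -> u != 0 ->
  u *m A = l *: u -> forall i, 0 < u 0 i.
Proof.
move=> u0 uN ul j; have [i ui] := row_neq0P u0 uN.
apply: (connect_invariant (P := fun i => 0 < u 0 i) _ (A_irr i j)) ui.
move=> {}i k Aik ui.
have : 0 < (u *m A) 0 k.
  rewrite mulmx_rowE (bigD1 i)//= ltr_wpDr ?mulr_gt0// sumr_ge0// => l' _.
  by rewrite mulr_ge0.
rewrite ul mxE [0 < u 0 k]lt0r u0 andbT; apply: contraTneq => ->.
by rewrite mulr0 ltxx.
Qed.

(** Take absolute values of the entries of an eigenvector and apply the triangle inequality, then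
    normalize. *)
Lemma eigenvalue_subeigen (mu : R) : eigenvalue A mu ->
  exists w, subeigen (`|mu|, w).
Proof.
case/eigenvalueP=> w wA wN; pose v := \row_i `|w 0 i|.
have v0 i : 0 <= v 0 i by rewrite mxE.
have vN : v != 0.
  apply: contra_neq wN => /rowP ve; apply/rowP => i; apply/eqP.
  by have /eqP := ve i; rewrite !mxE normr_eq0.
apply: (subeigen_normalize (normr_ge0 mu) v0 vN) => j.
have /rowP/(_ j) := wA; rewrite !mxE => /(congr1 Num.norm).
rewrite normrM => <-; apply: le_trans (ler_norm_sum _ _ _) _.
by apply: ler_sum => i _; rewrite normrM !mxE (ger0_norm (A_ge0 _ _)).
Qed.

Lemma eigenvalue_le (mu : R) : eigenvalue A mu -> mu <= \sum_j \sum_i A i j.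
Proof.
by move=> /eigenvalue_subeigen[w /subeigen_le]; apply/le_trans/ler_norm.
Qed.

(** The given eigenvalue makes the compact set [subeigen] nonempty and bounds the maximum of [l]
    below by its absolute value. A maximizer that is not an eigenpair would contradict
    [subeigenvector_improve]. *)
Lemma perron_eigenvector (mu : R) : eigenvalue A mu ->
  exists l u, [/\ mu <= l, (forall j, 0 < u 0 j) & u *m A = l *: u].
Proof.
move=> /eigenvalue_subeigen[v' v'P].
have cf : {within subeigen, continuous (fun p : R * 'rV[R]_m => p.1)}.
  by apply: continuous_subspaceT => p; exact: cvg_fst.
have [[l u] /set_mem lu lmax] :=
  compact_EVT_max (ex_intro _ _ v'P) subeigen_compact cf.
have [/= l0 u1 us ul] := lu.
have u0 i : 0 <= u 0 i by case/andP: (u1 i).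
have uN : u != 0.
  apply: contra_eqN us => /eqP->; rewrite big1 ?(eq_sym 0) ?oner_eq0// => i _.
  by rewrite mxE.
have uA : u *m A = l *: u.
  apply/eqP; apply: contraPT isT => /(subeigenvector_improve l0 u0 ul).
  move=> [l' [w' [ll' w'0 w'N w'l]]].
  have [w'' /mem_set/lmax/=] :=
    subeigen_normalize (le_trans l0 (ltW ll')) w'0 w'N w'l.
  by rewrite leNgt ll'.
exists l, u; split=> //; last exact: eigenvector_gt0 uA.
by apply: le_trans (ler_norm _) _; have /lmax := mem_set v'P.
Qed.

End Perron.

(** * Sums over monomials *)

Section Box.
Variables (R : realType) (m : nat).
Implicit Types (f g : mvfps R m) (K : nat).

(** A box of exponents, not a bound on the total degree, so that the index ranges agree with those
    of [mvfps_subst]. *)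
Definition box f K : R :=
  \sum_(n < K.+1) \sum_(k : {ffun 'I_m -> 'I_K.+1})
    f (n : nat, [ffun j => k j : nat]).

Definition in_box K : set (midx m) :=
  [set p : midx m | (p.1 <= K)%N /\ forall j, (p.2 j <= K)%N].

Lemma le_in_box f g K : (forall p, in_box K p -> f p <= g p) ->
  box f K <= box g K.
Proof.
move=> fg; apply: ler_sum => n _; apply: ler_sum => k _; apply: fg.
by split=> /= [|j]; rewrite ?ffunE -ltnS.
Qed.

Lemma le_box f g K : (forall p, f p <= g p) -> box f K <= box g K.
Proof. by move=> fg; apply: le_in_box => p _; exact: fg. Qed.

Lemma eq_box f g K : (forall p, f p = g p) -> box f K = box g K.
Proof. by move=> /funext->. Qed.

Lemma box_ge0 f K : (forall p, 0 <= f p) -> 0 <= box f K.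
Proof. by move=> f0; apply: sumr_ge0 => n _; apply: sumr_ge0. Qed.

Lemma boxD f g K : box (fun p => f p + g p) K = box f K + box g K.
Proof.
by rewrite -big_split; apply: eq_bigr => n _; rewrite -big_split.
Qed.

Lemma boxZ (c : R) f K : box (fun p => c * f p) K = c * box f K.
Proof.
rewrite [RHS]mulr_sumr; apply: eq_bigr => n _.
by rewrite [RHS]mulr_sumr.
Qed.

Lemma box_sum (I : Type) (r : seq I) (F : I -> mvfps R m) K :
  box (fun p => \sum_(i <- r) F i p) K = \sum_(i <- r) box (F i) K.
Proof.
elim: r => [|i r IHr].
  rewrite big_nil -[RHS](mul0r (box (fun=> 0) K)) -boxZ.
  by apply: eq_box => p; rewrite big_nil mul0r.
rewrite big_cons -IHr -boxD; apply: eq_box => p; by rewrite big_cons.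
Qed.

Lemma box_esum f K : (forall p, 0 <= f p) ->
  (box f K)%:E = (\esum_(p in in_box K) (f p)%:E)%E.
Proof.
move=> f0.
pose e (q : 'I_K.+1 * {ffun 'I_m -> 'I_K.+1}) : midx m :=
  (q.1 : nat, [ffun j => q.2 j : nat]).
have eI : set_inj setT e.
  move=> [n k] [n' k'] _ _ [/val_inj -> /ffunP kk']; congr pair.
  by apply/ffunP => j; apply/val_inj; have := kk' j; rewrite !ffunE.
have eB : in_box K = e @` setT.
  apply/seteqP; split=> [[n k] [/= nK kK]|_ [[n k] _ <-]]; last first.
    by split=> /= [|j]; rewrite ?ffunE -ltnS.
  exists (inord n, [ffun j => inord (k j)]) => //; congr pair => /=.
    by rewrite inordK.
  by apply/ffunP => j; rewrite !ffunE inordK ?ltnS.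
have fT : finite_set [set: 'I_K.+1 * {ffun 'I_m -> 'I_K.+1}].
  exact: finite_finset.
rewrite eB esum_image// esum_fset//; last by move=> q _; rewrite lee_fin.
rewrite fsumEFin//.
rewrite (_ : setT = [set` enum {: 'I_K.+1 * {ffun 'I_m -> 'I_K.+1}}]).
  by rewrite -fsbig_seq ?enum_uniq// big_enum /= /box pair_bigA.
by apply/seteqP; split=> // q _ /=; rewrite mem_enum.
Qed.

Lemma box_le_esum f K : (forall p, 0 <= f p) ->
  ((box f K)%:E <= \esum_(p in setT) (f p)%:E)%E.
Proof.
move=> f0; rewrite box_esum// esum_mkcond; apply: le_esum => p _.
by case: ifP => // _; rewrite lee_fin.
Qed.

Lemma box_le_supp f K l : (forall p, 0 <= f p) ->
  (forall p, ~ in_box l p -> f p = 0) -> box f K <= box f l.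
Proof.
move=> f0 fs; rewrite -lee_fin; apply: le_trans (box_le_esum K f0) _.
rewrite box_esum// [leRHS]esum_mkcond; apply: le_esum => p _.
by case: ifPn => // /negP pl; rewrite fs// => /mem_set.
Qed.

Lemma box_mono f : (forall p, 0 <= f p) ->
  {homo box f : K L / (K <= L)%N >-> K <= L}.
Proof.
move=> f0 K L KL; rewrite -lee_fin !box_esum//.
rewrite esum_mkcond [leRHS]esum_mkcond; apply: le_esum => p _.
case: ifPn => [/set_mem[p1 p2]|_]; last by case: ifP; rewrite lee_fin.
rewrite mem_set//; split; first exact: leq_trans KL.
by move=> j; apply: leq_trans KL.
Qed.

Lemma le_box_term f K p : (forall p, 0 <= f p) -> in_box K p -> f p <= box f K.
Proof.
move=> f0 pK; rewrite -lee_fin box_esum//; apply: esum_ge.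
exists [set p]; first by split=> // q ->.
by rewrite fsbig_set1.
Qed.

Lemma esum_le_box f (B : R) : (forall p, 0 <= f p) ->
  (forall K, box f K <= B) -> (\esum_(p in setT) (f p)%:E <= B%:E)%E.
Proof.
move=> f0 fB; apply: ge_ereal_sup => _ [F [Ff _] <-].
(* The largest total degree in the finite set [F] bounds each exponent separately. *)
have [K FK] : exists K, F `<=` in_box K.
  have /finite_seqP[s ->] := Ff.
  exists (\max_(p <- s) (p.1 + \sum_j p.2 j))%N => p /= pF.
  have pm : (p.1 + \sum_j p.2 j <= \max_(p <- s) (p.1 + \sum_j p.2 j))%N.
    by rewrite (big_rem p)//= leq_maxl.
  split; first by apply: leq_trans pm; rewrite leq_addr.
  move=> j; apply: leq_trans pm; apply: leq_trans (leq_addl _ _).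
  by rewrite (bigD1 j)//= leq_addr.
apply: le_trans (_ : (box f K)%:E <= _)%E; last by rewrite lee_fin.
by rewrite box_esum//; apply: ereal_sup_ubound; exists F.
Qed.

(** The true sum under [finite_sum]; otherwise [fine] returns the default 0. *)
Definition ssum f : R := fine (\esum_(p in setT) (f p)%:E)%E.

Definition finite_sum f : Prop := (\esum_(p in setT) (f p)%:E < +oo)%E.

Lemma finite_sum_fin f : (forall p, 0 <= f p) -> finite_sum f ->
  (ssum f)%:E = (\esum_(p in setT) (f p)%:E)%E.
Proof.
move=> f0 fs; rewrite fineK// ge0_fin_numE// esum_ge0// => p _.
by rewrite lee_fin.
Qed.

Lemma box_le_ssum f K : (forall p, 0 <= f p) -> finite_sum f ->
  box f K <= ssum f.
Proof. by move=> f0 fs; rewrite -lee_fin finite_sum_fin// box_le_esum. Qed.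

Lemma bounded_finite_sum f (B : R) : (forall p, 0 <= f p) ->
  (forall K, box f K <= B) -> finite_sum f /\ ssum f <= B.
Proof.
move=> f0 fB; have eB := esum_le_box f0 fB.
have fs : finite_sum f by apply: le_lt_trans eB (ltry _).
by rewrite -lee_fin finite_sum_fin.
Qed.

Lemma box_cvg f : (forall p, 0 <= f p) -> finite_sum f ->
  box f @ \oo --> ssum f.
Proof.
move=> f0 fs; have bs K := box_le_ssum K f0 fs.
have cv : cvgn (box f).
  apply: nondecreasing_is_cvgn; first by move=> K L; exact: box_mono.
  by exists (ssum f) => _ [K _ <-].
have bl K : box f K <= limn (box f).
  by apply: nondecreasing_cvgn_le => // ? ?; exact: box_mono.
suff <- : limn (box f) = ssum f by [].
apply/eqP; rewrite eq_le (limr_le cv)/=; last by apply: nearW.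
by case: (bounded_finite_sum f0 bl).
Qed.

Lemma finite_sum_le f g : (forall p, f p <= g p) -> finite_sum g ->
  finite_sum f.
Proof.
by move=> fg; apply: le_lt_trans; apply: le_esum => p _; rewrite lee_fin.
Qed.

End Box.

(** * Limits of box sums *)

Section BoxLimits.
Variables (R : realType) (m : nat).
Implicit Types (f g : mvfps R m).

(** Every box containing [p0] separates the two box sums by at least [g p0 - f p0], so the gap
    survives in the limit. *)
Lemma box_cvg_lt f g (s t : R) p0 : box f @ \oo --> s -> box g @ \oo --> t ->
  (forall p, f p <= g p) -> f p0 < g p0 -> s < t.
Proof.
move=> fs gt fg fg0; rewrite -subr_gt0; apply: (@lt_le_trans _ _ (g p0 - f p0)).
  by rewrite subr_gt0.
have h0 p : 0 <= g p + -1 * f p by rewrite mulN1r subr_ge0.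
have : box g \- box f @ \oo --> t - s by apply: cvgB.
move/cvgr_to_ge; apply.
have [K Kp] : exists K, in_box K p0.
  exists (p0.1 + \sum_j p0.2 j)%N; split; first exact: leq_addr.
  move=> j; apply: leq_trans (leq_addl _ _).
  by rewrite (bigD1 j)//= leq_addr.
exists K => // L /= KL; rewrite -[box f L]mul1r -mulNr -boxZ -boxD -[f p0]mul1r.
rewrite -mulNr; apply: (le_box_term h0); split.
  by apply: leq_trans KL; case: Kp.
by move=> j; apply: leq_trans KL; case: Kp.
Qed.

Lemma box_cvg_le f g (s t : R) : box f @ \oo --> s -> box g @ \oo --> t ->
  (forall p, f p <= g p) -> s <= t.
Proof.
move=> fs gt fg; apply: ler_cvg_to fs gt _.
by apply: nearW => K; exact: le_box.
Qed.

Lemma box_cvg_lin f (F : 'I_m -> mvfps R m) (w : 'I_m -> R) :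
  (forall p, 0 <= f p) -> finite_sum f ->
  (forall j p, 0 <= F j p) -> (forall j, finite_sum (F j)) ->
  box (fun p => f p + \sum_j w j * F j p) @ \oo -->
    ssum f + \sum_j w j * ssum (F j).
Proof.
move=> f0 fs F0 Fs.
rewrite (_ : box _ = fun K => box f K + \sum_j w j * box (F j) K).
  apply: cvgD; first exact: box_cvg.
  apply: cvg_big => [|j _]; first exact: add_continuous.
  by apply: cvgM; [exact: cvg_cst|exact: box_cvg].
apply/funext => K; rewrite boxD box_sum; congr (_ + _).
by apply: eq_bigr => j _; rewrite boxZ.
Qed.

End BoxLimits.

(** * Tangent inequalities *)

Section NonnegPoly.
Variable R : realType.
Implicit Types p q : {poly R}.

Definition nneg_poly p : Prop := forall i, 0 <= p`_i.

Lemma nneg_polyM p q : nneg_poly p -> nneg_poly q -> nneg_poly (p * q).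
Proof.
by move=> p0 q0 i; rewrite coefM; apply: sumr_ge0 => j _; rewrite mulr_ge0.
Qed.

Lemma nneg_poly1 : nneg_poly 1.
Proof. by move=> i; rewrite coef1 ler0n. Qed.

Lemma nneg_polyX p n : nneg_poly p -> nneg_poly (p ^+ n).
Proof.
move=> p0; elim: n => [|n IHn]; first exact: nneg_poly1.
by rewrite exprS; exact: nneg_polyM.
Qed.

Lemma nneg_poly_prod (I : finType) (F : I -> {poly R}) :
  (forall i, nneg_poly (F i)) -> nneg_poly (\prod_i F i).
Proof.
by move=> F0; apply: big_ind; [exact: nneg_poly1|exact: nneg_polyM|].
Qed.

Lemma nneg_poly_affine (u v : R) : 0 <= u -> 0 <= v ->
  nneg_poly (u%:P + v *: 'X).
Proof.
move=> u0 v0 i; rewrite coefD coefC coefZ coefX addr_ge0 ?mulr_ge0 ?ler0n//.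
by case: ifP.
Qed.

Lemma nneg_coefM_gt0 p q a b : nneg_poly p ->
  nneg_poly q -> 0 < p`_a -> 0 < q`_b -> 0 < (p * q)`_(a + b).
Proof.
move=> p0 q0 pa qb; rewrite coefM.
have aab : (a < (a + b).+1)%N by rewrite ltnS leq_addr.
rewrite (bigD1 (Ordinal aab))//= ltr_wpDr ?addKn ?mulr_gt0// sumr_ge0// => i _.
by rewrite mulr_ge0.
Qed.

(** The left side is the coefficient of degree 1, the right side the sum of all coefficients of
    positive degree. *)
Lemma nneg_poly_tangent0 p : nneg_poly p ->
  p^`().[0] <= p.[1] - p.[0].
Proof.
move=> p0; have sp : (size p <= (size p).+2)%N by do 2!apply: leqW.
rewrite !horner_coef0 coef_deriv mulr1n (horner_coef_wide _ sp).
rewrite !big_ord_recl/= !expr1n !mulr1 addrAC subrr add0r lerDl.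
apply: sumr_ge0 => i _.
by rewrite expr1n mulr1.
Qed.

(** The difference is the sum of [(i - 1) p_i] over [i >= 1], with the index shifted by one. For
    nonnegative coefficients it is nonnegative, and positive once some coefficient of degree at
    least 2 is. *)
Lemma horner_deriv1_sub p :
  p^`().[1] - (p.[1] - p.[0]) = \sum_(i < size p) p`_i.+1 *+ i.
Proof.
have sp : (size p <= (size p).+1)%N by [].
have sp' : (size p^`() <= size p)%N.
  by apply/leq_sizeP => j pj; rewrite coef_deriv nth_default ?mul0rn// ltnW.
rewrite (horner_coef_wide _ sp') (horner_coef_wide 1 sp) horner_coef0.
rewrite big_ord_recl /= expr1n mulr1 addrAC subrr add0r.
rewrite -sumrB; apply: eq_bigr => i _.
by rewrite !expr1n !mulr1 coef_deriv mulrSr addrK.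
Qed.

Lemma nneg_poly_tangent1 p : nneg_poly p ->
  p.[1] - p.[0] <= p^`().[1].
Proof.
move=> p0; rewrite -subr_ge0 horner_deriv1_sub.
by apply: sumr_ge0 => i _; rewrite mulrn_wge0.
Qed.

Lemma nneg_poly_tangent1_lt p i : nneg_poly p ->
  (1 < i)%N -> 0 < p`_i -> p.[1] - p.[0] < p^`().[1].
Proof.
case: i => [|[|i]]// p0 _ pi.
rewrite -subr_gt0 horner_deriv1_sub.
have isz : (i.+1 < size p)%N.
  rewrite ltnNge; apply: contraTN pi => sp.
  by rewrite nth_default ?ltxx// leqW.
rewrite (bigD1 (Ordinal isz))//= ltr_wpDr ?mulrn_wgt0//.
by apply: sumr_ge0 => k _; rewrite mulrn_wge0.
Qed.

Lemma deriv_prod (I : finType) (F : I -> {poly R}) :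
  (\prod_i F i)^`() = \sum_i (F i)^`() * \prod_(j | j != i) F j.
Proof.
(* In the induction the condition [j != i] must remove exactly one factor, hence duplicate-free
   sequences. *)
suff : forall r, uniq r -> (\prod_(i <- r) F i)^`() =
    \sum_(i <- r) (F i)^`() * \prod_(j <- r | j != i) F j.
  by apply; exact: index_enum_uniq.
elim=> [|a r IHr] /=; first by rewrite !big_nil derivC.
move=> /andP[ar ur]; rewrite !big_cons derivM eqxx /= IHr//; congr (_ + _).
  congr (_ * _); rewrite big_seq [RHS]big_seq_cond; apply: eq_bigl => j.
  by case: (boolP (j \in r)) => // jr; apply/esym; apply: contraNneq ar => <-.
rewrite mulr_sumr big_seq [RHS]big_seq; apply: eq_bigr => i ir.
rewrite big_cons ifT; first by rewrite mulrCA.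
by apply: contraNneq ar => ->.
Qed.

Variable m : nat.
Implicit Types (y d : 'rV[R]_m) (k : {ffun 'I_m -> nat}).

Definition monomial y k : R := \prod_j y 0 j ^+ k j.

(** The partial derivative of the monomial in [y_j]. When [k j = 0] the first factor makes it 0,
    whatever the truncated predecessor. *)
Definition dmonomial j y k : R :=
  (k j)%:R * y 0 j ^+ (k j).-1 * \prod_(l | l != j) y 0 l ^+ k l.

(* y^k along the segment t |-> y + t d: its coefficients are nonnegative, so its
   increment on [0, 1] lies between its derivatives at 0 and 1. *)
Let line y d k : {poly R} := \prod_j ((y 0 j)%:P + d 0 j *: 'X) ^+ k j.

Let line_nneg y d k : (forall j, 0 <= y 0 j) -> (forall j, 0 <= d 0 j) ->
  nneg_poly (line y d k).
Proof.
move=> y0 d0; rewrite /line; apply: nneg_poly_prod => j; apply: nneg_polyX.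
exact: nneg_poly_affine.
Qed.

Let horner_line y d k t : (line y d k).[t] = monomial (y + t *: d) k.
Proof.
rewrite horner_prod; apply: eq_bigr => j _.
by rewrite horner_exp !hornerE !mxE mulrC.
Qed.

Let deriv_line y d k t : (line y d k)^`().[t] =
  \sum_j d 0 j * dmonomial j (y + t *: d) k.
Proof.
rewrite deriv_prod horner_sum; apply: eq_bigr => j _.
rewrite hornerM horner_prod deriv_exp derivD derivC add0r derivZ derivX.
rewrite hornerMn hornerM horner_exp !hornerE !mxE /dmonomial -mulr_natl.
rewrite mulrCA !mulrA [t * _]mulrC; congr (_ * _); apply: eq_bigr => l _.
by rewrite horner_exp !hornerE !mxE [t * _]mulrC.
Qed.

Lemma monomial_tangent0 y y' k :
  (forall j, 0 <= y 0 j) -> (forall j, y 0 j <= y' 0 j) ->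
  \sum_j (y' 0 j - y 0 j) * dmonomial j y k <= monomial y' k - monomial y k.
Proof.
move=> y0 yy'; have := @nneg_poly_tangent0 (line y (y' - y) k).
rewrite deriv_line !horner_line scale0r addr0 scale1r [y + _]addrC subrK.
under eq_bigr do rewrite !mxE.
by apply; apply: line_nneg => // j; rewrite !mxE subr_ge0.
Qed.

Lemma monomial_tangent1 y y' k :
  (forall j, 0 <= y 0 j) -> (forall j, y 0 j <= y' 0 j) ->
  monomial y' k - monomial y k <= \sum_j (y' 0 j - y 0 j) * dmonomial j y' k.
Proof.
move=> y0 yy'; have := @nneg_poly_tangent1 (line y (y' - y) k).
rewrite deriv_line !horner_line scale0r addr0 scale1r [y + _]addrC subrK.
under eq_bigr do rewrite !mxE.
by apply; apply: line_nneg => // j; rewrite !mxE subr_ge0.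
Qed.

(** The top coefficient is the product of the [d_j ^ k_j]. With total degree above 1 it makes the
    tangent inequality at the upper end strict. *)
Let line_lead y d k : (forall j, 0 <= y 0 j) -> (forall j, 0 < d 0 j) ->
  0 < (line y d k)`_(\sum_j k j).
Proof.
move=> y0 d0.
have nn j : nneg_poly ((y 0 j)%:P + d 0 j *: 'X).
  by apply: nneg_poly_affine => //; exact: ltW.
suff [] : 0 < (line y d k)`_(\sum_j k j) /\ nneg_poly (line y d k).
  by [].
rewrite /line; apply: (big_rec2 (fun (p : {poly R}) n => 0 < p`_n /\
  nneg_poly p)).
  by rewrite coef1 eqxx ltr01; split => //; exact: nneg_poly1.
move=> j n p _ [pn pnn]; split; last first.
  by apply: nneg_polyM => //; exact: nneg_polyX.
apply: nneg_coefM_gt0 => //; first exact: nneg_polyX.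
elim: (k j) => [|e IHe]; first by rewrite expr0 coef1 ltr01.
rewrite exprS -[e.+1]add1n.
apply: nneg_coefM_gt0 => //; first exact: nneg_polyX.
by rewrite coefD coefC coefZ coefX/= mulr1 add0r.
Qed.

Lemma monomial_tangent1_lt y y' k : (1 < \sum_j k j)%N ->
  (forall j, 0 <= y 0 j) -> (forall j, y 0 j < y' 0 j) ->
  monomial y' k - monomial y k < \sum_j (y' 0 j - y 0 j) * dmonomial j y' k.
Proof.
move=> k1 y0 yy'.
have dj j : 0 < (y' - y) 0 j by rewrite !mxE subr_gt0.
have := nneg_poly_tangent1_lt (line_nneg k y0 (fun j => ltW (dj j))) k1
  (line_lead k y0 dj).
rewrite deriv_line !horner_line scale0r addr0 scale1r [y + _]addrC subrK.
by under eq_bigr do rewrite !mxE.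
Qed.

Lemma monomial_ge0 y k : (forall j, 0 <= y 0 j) -> 0 <= monomial y k.
Proof. by move=> y0; apply: prodr_ge0 => j _; rewrite exprn_ge0. Qed.

Lemma monomial_le y y' k : (forall j, 0 <= y 0 j) ->
  (forall j, y 0 j <= y' 0 j) -> monomial y k <= monomial y' k.
Proof.
move=> y0 yy'; apply: ler_prod => j _; rewrite exprn_ge0//=.
by apply: lerXn2r; rewrite // nnegrE// (le_trans (y0 j)).
Qed.

Lemma dmonomial_ge0 j y k : (forall j, 0 <= y 0 j) -> 0 <= dmonomial j y k.
Proof.
move=> y0; rewrite /dmonomial !mulr_ge0 ?exprn_ge0//.
by apply: prodr_ge0 => l _; rewrite exprn_ge0.
Qed.

End NonnegPoly.

(** * Power series with nonnegative coefficients *)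

Section Series.
Variables (R : realType) (m : nat).
Implicit Types (c : mvfps R m) (x : R) (y : 'rV[R]_m).

Definition incr_exponent j (p : midx m) : midx m :=
  (p.1, [ffun l => (p.2 l + (l == j))%N]).

(** [incr_exponent j] is a bijection onto the monomials that contain [y_j], and [f] vanishes on the
    others. *)
Lemma esum_incr_exponent j (f : mvfps R m) :
  (forall p : midx m, p.2 j = 0%N -> f p = 0) ->
  (\esum_(p in setT) (f (incr_exponent j p))%:E = \esum_(p in setT) (f p)%:E)%E.
Proof.
move=> f0; have sb :
    set_bij setT [set p : midx m | (0 < p.2 j)%N] (incr_exponent j).
  split=> [p _ /=|[n k] [n' k'] _ _ [-> /ffunP kk']|[n k] /= kj].
  - by rewrite ffunE eqxx addn1.
  - congr pair; apply/ffunP => l; have := kk' l; rewrite !ffunE.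
    exact: addIn.
  - exists (n, [ffun l => (k l - (l == j))%N]) => //; congr pair => /=.
    apply/ffunP => l; rewrite !ffunE; case: eqP => [->|_]; first exact: subnK.
    by rewrite subn0 addn0.
rewrite -(@reindex_esum R _ _ _ _ _ (fun p => (f p)%:E) sb) esum_mkcond.
apply: eq_esum => p _; case: ifPn => // /negP pj; rewrite f0//.
by apply/eqP; rewrite -leqn0 leqNgt; apply: contra_notN pj => /mem_set.
Qed.

(* Indexed by the monomial of c, not of its derivative, so that terms of c and
   of its derivatives can be compared one by one. *)
Definition dterm j c x y (p : midx m) : R :=
  c p * x ^+ p.1 * dmonomial j y p.2.

Lemma term_dy j c x y p :
  mvfps_term (mvfps_dy j c) x y p = dterm j c x y (incr_exponent j p).
Proof.
rewrite /mvfps_term /mvfps_dy /dterm /dmonomial /= !ffunE eqxx addn1 /=.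
rewrite (bigD1 j)//= [_ * c _]mulrC -!mulrA; congr (_ * _).
rewrite mulrCA; congr (_ * (_ * (_ * _))).
by apply: eq_bigr => l /negPf lj; rewrite ffunE lj addn0.
Qed.

Lemma esum_dy j c x y :
  (\esum_(p in setT) (mvfps_term (mvfps_dy j c) x y p)%:E =
   \esum_(p in setT) (dterm j c x y p)%:E)%E.
Proof.
rewrite -[RHS](@esum_incr_exponent j).
  by apply: eq_esum => p _; rewrite term_dy.
by move=> p pj; rewrite /dterm /dmonomial pj !mul0r mulr0.
Qed.

Lemma mvfps_eval_dy j c x y :
  mvfps_eval (mvfps_dy j c) x y = ssum (dterm j c x y).
Proof. by rewrite /mvfps_eval esum_dy. Qed.

Lemma mvfps_term_ge0 c x y p : (forall p, 0 <= c p) -> 0 <= x ->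
  (forall j, 0 <= y 0 j) -> 0 <= mvfps_term c x y p.
Proof.
move=> c0 x0 y0; rewrite /mvfps_term mulr_ge0 ?mulr_ge0 ?exprn_ge0//.
exact: monomial_ge0.
Qed.

Lemma mvfps_term_le c x x' y y' p : (forall p, 0 <= c p) -> 0 <= x ->
  x <= x' -> (forall j, 0 <= y 0 j) -> (forall j, y 0 j <= y' 0 j) ->
  mvfps_term c x y p <= mvfps_term c x' y' p.
Proof.
move=> c0 x0 xx' y0 yy'; have x'0 := le_trans x0 xx'.
rewrite /mvfps_term ler_pM ?mulr_ge0 ?exprn_ge0 ?monomial_ge0//.
  by apply: ler_wpM2l => //; rewrite lerXn2r// nnegrE.
exact: monomial_le.
Qed.

Lemma dterm_ge0 j c x y p : (forall p, 0 <= c p) -> 0 <= x ->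
  (forall j, 0 <= y 0 j) -> 0 <= dterm j c x y p.
Proof.
move=> c0 x0 y0; apply: mulr_ge0; last exact: dmonomial_ge0.
by rewrite mulr_ge0 ?exprn_ge0.
Qed.

Lemma mvfps_dy_ge0 j c : (forall p, 0 <= c p) ->
  forall p, 0 <= mvfps_dy j c p.
Proof. by move=> c0 p; rewrite mulr_ge0. Qed.

Lemma convergesE c x y : (forall p, 0 <= c p) -> 0 <= x ->
  (forall j, 0 <= y 0 j) ->
  mvfps_converges c x y <-> finite_sum (mvfps_term c x y).
Proof.
move=> c0 x0 y0; rewrite /mvfps_converges /summable /finite_sum.
rewrite (eq_esum (b := fun p => (mvfps_term c x y p)%:E))// => p _.
by rewrite gee0_abs// lee_fin mvfps_term_ge0.
Qed.

Lemma converges_le c x x' y y' : (forall p, 0 <= c p) -> 0 <= x ->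
  x <= x' -> (forall j, 0 <= y 0 j) -> (forall j, y 0 j <= y' 0 j) ->
  mvfps_converges c x' y' -> mvfps_converges c x y.
Proof.
move=> c0 x0 xx' y0 yy'.
have y'0 j : 0 <= y' 0 j by apply: le_trans (yy' j).
rewrite !convergesE ?(le_trans x0)//; apply: finite_sum_le => p.
exact: mvfps_term_le.
Qed.

Lemma finite_sum_dterm j c x y : (forall p, 0 <= c p) -> 0 <= x ->
  (forall j, 0 <= y 0 j) -> mvfps_converges (mvfps_dy j c) x y ->
  finite_sum (dterm j c x y).
Proof.
move=> c0 x0 y0 /convergesE; rewrite /finite_sum esum_dy; apply => //.
exact: mvfps_dy_ge0.
Qed.

(** * Tangent inequality at the lower point *)

Section Tangent.
Variables (c : mvfps R m) (x x' : R) (y y' : 'rV[R]_m).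
Hypothesis c_ge0 : forall p, 0 <= c p.
Hypothesis x_ge0 : 0 <= x.
Hypothesis xx' : x <= x'.
Hypothesis y_ge0 : forall j, 0 <= y 0 j.
Hypothesis yy' : forall j, y 0 j <= y' 0 j.

Let x'_ge0 : 0 <= x'. Proof. exact: le_trans xx'. Qed.
Let y'_ge0 j : 0 <= y' 0 j. Proof. exact: le_trans (yy' j). Qed.

(** The increment splits into [c (x'^n - x^n) y'^k] and [c x^n (y'^k - y^k)]. The second part is
    bounded by the tangent of the monomial at [y]; the first is kept as a surplus for the strict
    version. *)
Let tangent_term p :
  c p * (x' ^+ p.1 - x ^+ p.1) * monomial y' p.2 +
  (mvfps_term c x y p + \sum_j (y' 0 j - y 0 j) * dterm j c x y p) <=
  mvfps_term c x' y' p.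
Proof.
have := monomial_tangent0 p.2 y_ge0 yy'; rewrite -lerBrDl => le0.
have {}le0 := ler_wpM2l (mulr_ge0 (c_ge0 p) (exprn_ge0 p.1 x_ge0)) le0.
have -> : \sum_j (y' 0 j - y 0 j) * dterm j c x y p =
    c p * x ^+ p.1 * \sum_j (y' 0 j - y 0 j) * dmonomial j y p.2.
  by rewrite mulr_sumr; apply: eq_bigr => j _; rewrite mulrCA.
rewrite /mvfps_term -/(monomial y p.2) -/(monomial y' p.2).
move: le0; set S := \sum_j _; nra.
Qed.

Let fs_term : mvfps_converges c x' y' -> finite_sum (mvfps_term c x y).
Proof. by move/(converges_le c_ge0 x_ge0 xx' y_ge0 yy')/convergesE; exact. Qed.

Let term_ge0 p : 0 <= mvfps_term c x y p.
Proof. exact: mvfps_term_ge0. Qed.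

Let term'_ge0 p : 0 <= mvfps_term c x' y' p.
Proof. exact: mvfps_term_ge0. Qed.

Let lower_ge0 p : 0 <= c p * (x' ^+ p.1 - x ^+ p.1) * monomial y' p.2.
Proof.
apply: mulr_ge0; last exact: monomial_ge0.
by rewrite mulr_ge0// subr_ge0 lerXn2r// nnegrE.
Qed.

Let box_lower :
  mvfps_converges c x' y' -> (forall j, mvfps_converges (mvfps_dy j c) x y) ->
  box (fun p => mvfps_term c x y p +
    \sum_j (y' 0 j - y 0 j) * dterm j c x y p) @ \oo -->
  mvfps_eval c x y + \sum_j (y' 0 j - y 0 j) * mvfps_eval (mvfps_dy j c) x y.
Proof.
move=> cc cd; under [X in _ --> _ + X]eq_bigr do rewrite mvfps_eval_dy.
apply: box_cvg_lin => //; first exact: fs_term.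
- by move=> j p; exact: dterm_ge0.
- by move=> j; exact: finite_sum_dterm.
Qed.

Let box_upper : mvfps_converges c x' y' ->
  box (mvfps_term c x' y') @ \oo --> mvfps_eval c x' y'.
Proof. by move=> /convergesE cc; apply: box_cvg => //; exact: cc. Qed.

Lemma mvfps_eval_tangent0 : mvfps_converges c x' y' ->
  (forall j, mvfps_converges (mvfps_dy j c) x y) ->
  mvfps_eval c x y + \sum_j (y' 0 j - y 0 j) * mvfps_eval (mvfps_dy j c) x y <=
  mvfps_eval c x' y'.
Proof.
move=> cc cd; apply: (box_cvg_le (box_lower cc cd) (box_upper cc)) => p.
by apply: le_trans (tangent_term p); rewrite lerDr.
Qed.

(** For a pure power of [x] the surplus in [tangent_term] is [c (x'^n - x^n)], which is positive. *)
Lemma mvfps_eval_tangent0_lt n : (0 < n)%N -> 0 < c (n, [ffun=> 0%N]) ->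
  x < x' -> mvfps_converges c x' y' ->
  (forall j, mvfps_converges (mvfps_dy j c) x y) ->
  mvfps_eval c x y + \sum_j (y' 0 j - y 0 j) * mvfps_eval (mvfps_dy j c) x y <
  mvfps_eval c x' y'.
Proof.
move=> n0 cn xx'_lt cc cd.
apply: (box_cvg_lt (p0 := (n, [ffun=> 0%N])) (box_lower cc cd) (box_upper cc)).
  by move=> p; apply: le_trans (tangent_term p); rewrite lerDr.
apply: lt_le_trans (tangent_term _); rewrite ltrDr /= mulr_gt0//.
  by rewrite mulr_gt0// subr_gt0 ltrXn2r// -lt0n.
by rewrite /monomial big1// => j _; rewrite ffunE expr0.
Qed.

End Tangent.

(** * Tangent inequality at the upper point *)

Section Tangent1.
Variables (c : mvfps R m) (x : R) (y y' : 'rV[R]_m).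
Hypothesis c_ge0 : forall p, 0 <= c p.
Hypothesis x_ge0 : 0 <= x.
Hypothesis y_ge0 : forall j, 0 <= y 0 j.
Hypothesis yy' : forall j, y 0 j <= y' 0 j.
Hypothesis c_cvg : mvfps_converges c x y'.
Hypothesis dc_cvg : forall j, mvfps_converges (mvfps_dy j c) x y'.

Let y'_ge0 j : 0 <= y' 0 j. Proof. exact: le_trans (yy' j). Qed.

Let sum_dterm p : \sum_j (y' 0 j - y 0 j) * dterm j c x y' p =
  c p * x ^+ p.1 * \sum_j (y' 0 j - y 0 j) * dmonomial j y' p.2.
Proof. by rewrite mulr_sumr; apply: eq_bigr => j _; rewrite mulrCA. Qed.

Let c_cvg_y : mvfps_converges c x y.
Proof. exact: converges_le c_cvg. Qed.

Let box_upper : box (fun p => mvfps_term c x y p +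
    \sum_j (y' 0 j - y 0 j) * dterm j c x y' p) @ \oo -->
  mvfps_eval c x y + \sum_j (y' 0 j - y 0 j) * mvfps_eval (mvfps_dy j c) x y'.
Proof.
under [X in _ --> _ + X]eq_bigr do rewrite mvfps_eval_dy.
apply: box_cvg_lin => //.
- by move=> p; exact: mvfps_term_ge0.
- by move/convergesE : c_cvg_y; exact.
- by move=> j p; exact: dterm_ge0.
- by move=> j; exact: finite_sum_dterm.
Qed.

Let box_lower : box (mvfps_term c x y') @ \oo --> mvfps_eval c x y'.
Proof.
apply: box_cvg => [p|]; first exact: mvfps_term_ge0.
by move/convergesE : c_cvg; exact.
Qed.

Let tangent_term p : mvfps_term c x y' p <=
  mvfps_term c x y p + \sum_j (y' 0 j - y 0 j) * dterm j c x y' p.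
Proof.
rewrite sum_dterm /mvfps_term -/(monomial y p.2) -/(monomial y' p.2) -mulrDr.
rewrite ler_wpM2l ?mulr_ge0 ?exprn_ge0// addrC -lerBlDr.
exact: monomial_tangent1.
Qed.

Lemma mvfps_eval_tangent1 : mvfps_eval c x y' <=
  mvfps_eval c x y + \sum_j (y' 0 j - y 0 j) * mvfps_eval (mvfps_dy j c) x y'.
Proof. exact: box_cvg_le box_lower box_upper tangent_term. Qed.

Lemma mvfps_eval_tangent1_lt p : 0 < x -> (forall j, y 0 j < y' 0 j) ->
  0 < c p -> (1 < \sum_j p.2 j)%N -> mvfps_eval c x y' <
  mvfps_eval c x y + \sum_j (y' 0 j - y 0 j) * mvfps_eval (mvfps_dy j c) x y'.
Proof.
move=> x0 yy'_lt cp p2.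
apply: (box_cvg_lt (p0 := p) box_lower box_upper tangent_term).
rewrite sum_dterm /mvfps_term -/(monomial y p.2) -/(monomial y' p.2) -mulrDr.
rewrite ltr_pM2l ?mulr_gt0 ?exprn_gt0// addrC -ltrBlDr.
exact: monomial_tangent1_lt.
Qed.

End Tangent1.

Lemma mvfps_term_le_eval c x y p : (forall p, 0 <= c p) -> 0 <= x ->
  (forall j, 0 <= y 0 j) -> mvfps_converges c x y ->
  mvfps_term c x y p <= mvfps_eval c x y.
Proof.
move=> c0 x0 y0 /convergesE cc.
have t0 q : 0 <= mvfps_term c x y q by exact: mvfps_term_ge0.
apply: le_trans (box_le_ssum (p.1 + \sum_j p.2 j) t0 (cc _ _ _)) => //.
apply: le_box_term => //; split; first exact: leq_addr.
move=> j; apply: leq_trans (leq_addl _ _).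
by rewrite (bigD1 j)//= leq_addr.
Qed.

Lemma mvfps_eval_gt0 c x y : (forall p, 0 <= c p) -> 0 < x ->
  (forall j, 0 < y 0 j) -> mvfps_converges c x y -> mvfps_neq0 c ->
  0 < mvfps_eval c x y.
Proof.
move=> c0 x0 y0 cc [p cp].
apply: lt_le_trans (mvfps_term_le_eval p c0 (ltW x0) (fun j => ltW (y0 j)) cc).
apply: mulr_gt0; last by apply: prodr_gt0 => j _; rewrite exprn_gt0.
by rewrite mulr_gt0 ?exprn_gt0// lt0r cp c0.
Qed.

Lemma mvfps_eval_ge0 c x y : (forall p, 0 <= c p) -> 0 <= x ->
  (forall j, 0 <= y 0 j) -> 0 <= mvfps_eval c x y.
Proof.
move=> c0 x0 y0; apply: fine_ge0; apply: esum_ge0 => p _.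
by rewrite lee_fin mvfps_term_ge0.
Qed.

Lemma mvfps_eval_le c x y y' : (forall p, 0 <= c p) -> 0 <= x ->
  (forall j, 0 <= y 0 j) -> (forall j, y 0 j <= y' 0 j) ->
  mvfps_converges c x y' -> mvfps_eval c x y <= mvfps_eval c x y'.
Proof.
move=> c0 x0 y0 yy' cc.
have y'0 j : 0 <= y' 0 j by exact: le_trans (yy' j).
have c1 := converges_le c0 x0 (lexx x) y0 yy' cc.
have le p := mvfps_term_le p c0 x0 (lexx x) y0 yy'.
apply: (box_cvg_le _ _ le); apply: box_cvg => [p|].
- exact: mvfps_term_ge0.
- by move/convergesE : c1; exact.
- exact: mvfps_term_ge0.
- by move/convergesE : cc; exact.
Qed.

Lemma box_term_cvg c x K (y_ : nat -> 'rV[R]_m) y :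
  (forall j, y_ n 0 j @[n --> \oo] --> y 0 j) ->
  box (mvfps_term c x (y_ n)) K @[n --> \oo] --> box (mvfps_term c x y) K.
Proof.
move=> y_cvg; apply: cvg_big => [|k _]; first exact: add_continuous.
apply: cvg_big => [|k' _]; first exact: add_continuous.
apply: cvgM; first exact: cvg_cst.
apply: cvg_big => [|j _]; first exact: mul_continuous.
exact: (continuous_cvg _ (@exprn_continuous _ _ _) (y_cvg j)).
Qed.

(* Each box truncation is continuous in y and the y_ n lie below y, so lower
   semicontinuity suffices. *)
Lemma mvfps_eval_cvg c x (y_ : nat -> 'rV[R]_m) y : (forall p, 0 <= c p) ->
  0 <= x -> (forall n j, 0 <= y_ n 0 j) -> (forall n j, y_ n 0 j <= y 0 j) ->
  (forall j, y_ n 0 j @[n --> \oo] --> y 0 j) -> mvfps_converges c x y ->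
  mvfps_eval c x (y_ n) @[n --> \oo] --> mvfps_eval c x y.
Proof.
move=> c0 x0 y_0 y_y y_cvg cc.
have y0 j : 0 <= y 0 j by exact: le_trans (y_y 0%N j).
have le n : mvfps_eval c x (y_ n) <= mvfps_eval c x y by exact: mvfps_eval_le.
have t0 (z : 'rV[R]_m) p : (forall j, 0 <= z 0 j) -> 0 <= mvfps_term c x z p.
  by move=> z0; exact: mvfps_term_ge0.
have bc : box (mvfps_term c x y) @ \oo --> mvfps_eval c x y.
  by apply: box_cvg => [p|]; [exact: t0|move/convergesE : cc; exact].
apply/cvgrPdist_lt => e e0.
have e20 : 0 < e / 2 by rewrite divr_gt0.
have /cvgrPdist_lt/(_ _ e20)[K _ /(_ K (leqnn K))/= bK] := bc.
have bKc := @box_term_cvg c x K y_ y y_cvg.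
move/cvgrPdist_lt : bKc => /(_ _ e20); apply: filterS => n bn /=.
rewrite ger0_norm ?subr_ge0//.
have cn : mvfps_converges c x (y_ n) by exact: converges_le cc.
have : box (mvfps_term c x (y_ n)) K <= mvfps_eval c x (y_ n).
  by apply: box_le_ssum => [p|]; [exact: t0|move/convergesE : cn; exact].
move: bK bn => /ltr_normlW + /ltr_normlW; lra.
Qed.

End Series.

(** * Truncations of the standard solution *)

Section CoefDomination.
Variable R : realType.
Implicit Types p q : {poly R}.

(** The comparison stops at degree [l] because a truncation of order [N'] dominates another one only
    in degrees up to [N']. *)
Definition coef_dominated l p q : Prop :=
  forall i, (i <= l)%N -> 0 <= p`_i <= q`_i.

Lemma coef_dominatedM l p q p' q' : coef_dominated l p p' ->
  coef_dominated l q q' -> coef_dominated l (p * q) (p' * q').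
Proof.
move=> pp qq i il; rewrite !coefM sumr_ge0 => [|k _]; last first.
  have ki : (k <= l)%N by apply: leq_trans il; rewrite -ltnS.
  have /andP[p0 _] := pp _ ki.
  have /andP[q0 _] := qq _ (leq_trans (leq_subr k i) il).
  exact: mulr_ge0.
apply: ler_sum => k _.
have ki : (k <= l)%N by apply: leq_trans il; rewrite -ltnS.
have /andP[p0 ?] := pp _ ki.
have /andP[q0 ?] := qq _ (leq_trans (leq_subr k i) il).
exact: ler_pM.
Qed.

Lemma coef_dominated_refl l p : nneg_poly p -> coef_dominated l p p.
Proof. by move=> p0 i _; rewrite p0 lexx. Qed.

Lemma coef_dominatedX l p p' n : coef_dominated l p p' ->
  coef_dominated l (p ^+ n) (p' ^+ n).
Proof.
move=> pp; elim: n => [|n IHn]; last by rewrite !exprS; exact: coef_dominatedM.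
exact/coef_dominated_refl/nneg_poly1.
Qed.

Lemma coef_dominated_prod (I : finType) l (F F' : I -> {poly R}) :
  (forall i, coef_dominated l (F i) (F' i)) ->
  coef_dominated l (\prod_i F i) (\prod_i F' i).
Proof.
move=> FF; apply: (big_ind2 (coef_dominated l)) => //.
  exact/coef_dominated_refl/nneg_poly1.
by move=> p p' q q'; exact: coef_dominatedM.
Qed.

Lemma nneg_poly_truncate_le n p x : nneg_poly p -> 0 <= x ->
  \sum_(l < n) p`_l * x ^+ l <= p.[x].
Proof.
move=> p0 x0; rewrite (@horner_coef_wide _ (n + size p)) ?leq_addl//.
rewrite big_split_ord /= lerDl sumr_ge0// => i _.
by rewrite mulr_ge0 ?exprn_ge0.
Qed.

End CoefDomination.

Section Solution.
Variables (R : realType) (m : nat) (T : 'I_m -> nat -> R).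
Hypothesis T_ge0 : forall i n, 0 <= T i n.
Hypothesis T_at0 : forall i, T i 0%N = 0.
Implicit Types (c : mvfps R m) (x : R).

Definition trunc N j : {poly R} := \poly_(l < N.+1) T j l.

Definition psum N x : 'rV[R]_m := \row_j (trunc N j).[x].

Let mterm N (p : midx m) : {poly R} :=
  'X^(p.1) * \prod_j trunc N j ^+ p.2 j.

Lemma psumE N x j : psum N x 0 j = \sum_(l < N.+1) T j l * x ^+ l.
Proof. by rewrite mxE horner_poly. Qed.

Lemma psum_ge0 N x j : 0 <= x -> 0 <= psum N x 0 j.
Proof.
by move=> x0; rewrite psumE sumr_ge0// => l _; rewrite mulr_ge0 ?exprn_ge0.
Qed.

Lemma psum_pseries N x j : psum N x 0 j = pseries (T j) x N.+1.
Proof. by rewrite psumE /pseries seriesEord. Qed.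

Lemma pseries_mono x j : 0 <= x ->
  {homo pseries (T j) x : M N / (M <= N)%N >-> M <= N}.
Proof.
by move=> x0; apply: nondecreasing_series => n _ _; rewrite mulr_ge0 ?exprn_ge0.
Qed.

Let nneg_trunc N j : nneg_poly (trunc N j).
Proof. by move=> i; rewrite coef_poly; case: ifP. Qed.

Let nneg_mterm N p : nneg_poly (mterm N p).
Proof.
apply: nneg_polyM; last by apply: nneg_poly_prod => j; exact: nneg_polyX.
by move=> i; rewrite coefXn.
Qed.

Let trunc_dominated i N N' j : (i <= N')%N ->
  coef_dominated i (trunc N j) (trunc N' j).
Proof.
move=> iN' l li; rewrite !coef_poly !ltnS (leq_trans li iN').
by case: ifP; rewrite ?lexx T_ge0.
Qed.

(** The factor [X^(p.1)] shifts degrees, so only degrees up to [l - p.1] of the truncations matter.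
    A positive power of [x] thus gains at least one order. *)
Let mterm_dominated l N N' p : (l - p.1 <= N')%N ->
  (mterm N p)`_l <= (mterm N' p)`_l.
Proof.
move=> lN'; rewrite !coefXnM; case: ifP => // _.
have /(_ _ (leqnn _))/andP[]// : coef_dominated (l - p.1)
    (\prod_j trunc N j ^+ p.2 j) (\prod_j trunc N' j ^+ p.2 j).
by apply: coef_dominated_prod => j; exact/coef_dominatedX/trunc_dominated.
Qed.

(** Each truncation is divisible by [X] because [T_j] has no constant term, so an exponent above [l]
    pushes the whole product above degree [l]. *)
Let mterm_out l N p : ~ in_box l p -> (mterm N p)`_l = 0.
Proof.
move=> pl; rewrite /mterm; have [lp|pl1] := ltnP l p.1.
  by rewrite coefXnM lp.
have [j jl] : exists j, (l < p.2 j)%N.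
  apply: contrapT => /forallNP nl; apply: pl; split => // j.
  by rewrite leqNgt; exact/negP/nl.
rewrite (bigD1 j)//= mulrCA.
have -> : trunc N j = 'X * \poly_(i < N) T j i.+1.
  rewrite /trunc; apply/polyP => -[|i]; first by rewrite coefXM coef_poly T_at0.
  by rewrite coefXM !coef_poly.
by rewrite exprMn -mulrA coefXnM jl.
Qed.

Let horner_mterm c N x p :
  c p * (mterm N p).[x] = mvfps_term c x (psum N x) p.
Proof.
rewrite /mvfps_term hornerM hornerXn horner_prod mulrA; congr (_ * _).
by apply: eq_bigr => j _; rewrite horner_exp mxE.
Qed.

Let substE c l : mvfps_subst c T l = box (fun p => c p * (mterm l p)`_l) l.
Proof.
apply: eq_bigr => n _; apply: eq_bigr => k _.
congr (_ * nth _ (polyseq (_ * _)) _).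
by apply: eq_bigr => j _; rewrite /= ffunE.
Qed.

(** Every monomial of [c] contains [x], so the coefficients of [c(x, T(x))] up to degree [N + 1]
    involve [T] only up to degree [N]. *)
Lemma psumS_le_box c N x i : (forall p, 0 <= c p) ->
  (forall k, c (0%N, k) = 0) -> (forall n, T i n = mvfps_subst c T n) ->
  0 <= x -> psum N.+1 x 0 i <= box (mvfps_term c x (psum N x)) N.+1.
Proof.
move=> c0 cx0 Tfix x0; rewrite psumE.
apply: (@le_trans _ _ (\sum_(l < N.+2)
    x ^+ l * box (fun p => c p * (mterm N p)`_l) N.+1)).
  apply: ler_sum => l _; rewrite mulrC ler_wpM2l ?exprn_ge0//.
  rewrite Tfix substE; have lN : (l <= N.+1)%N by rewrite -ltnS.
  have m0 p : 0 <= c p * (mterm l p)`_l by rewrite mulr_ge0// nneg_mterm.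
  apply: le_trans (box_mono m0 lN) _.
  apply: le_box => -[[|n] k]; first by rewrite cx0 !mul0r.
  apply: ler_wpM2l => //; apply: mterm_dominated; rewrite /= leq_subLR.
  by apply: leq_trans lN _; rewrite addSn ltnS leq_addl.
under eq_bigr do rewrite -boxZ.
rewrite -box_sum; apply: le_box => p; rewrite -horner_mterm.
apply: le_trans (_ : c p * \sum_(l < N.+2) (mterm N p)`_l * x ^+ l <= _).
  by rewrite mulr_sumr ler_sum// => l _; rewrite mulrCA [_ * x ^+ l]mulrC.
by rewrite ler_wpM2l// nneg_poly_truncate_le.
Qed.

(** The box sum is the value at [x] of a polynomial whose coefficient of degree [l] is at most
    [T i l], hence it is bounded by a long enough partial sum of [T i]. *)
Lemma box_psum_le c M K x i (t : R) : (forall p, 0 <= c p) ->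
  (forall n, T i n = mvfps_subst c T n) -> 0 <= x ->
  (forall N, psum N x 0 i <= t) -> box (mvfps_term c x (psum M x)) K <= t.
Proof.
move=> c0 Tfix x0 tP.
(* The sum of all sizes over the box serves as a common bound on the sizes. *)
pose sz (p : midx m) : R := (size (mterm M p))%:R.
have [L szL] : exists L, forall p, in_box K p -> (size (mterm M p) <= L)%N.
  exists (Num.bound (box sz K)) => p pK; rewrite -(ler_nat R).
  apply: le_trans (_ : box sz K <= _); first exact: le_box_term.
  by apply/ltW/archi_boundP/box_ge0.
apply: le_trans (tP L); rewrite psumE.
apply: (@le_trans _ _ (\sum_(l < L) T i l * x ^+ l)); last first.
  by rewrite big_ord_recr /= lerDl mulr_ge0 ?exprn_ge0.
apply: (@le_trans _ _ (\sum_(l < L)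
    x ^+ l * box (fun p => c p * (mterm M p)`_l) K)); last first.
  apply: ler_sum => l _; rewrite [leRHS]mulrC ler_wpM2l ?exprn_ge0//.
  rewrite Tfix substE.
  have m0 p : 0 <= c p * (mterm M p)`_l by rewrite mulr_ge0// nneg_mterm.
  (* The fixed [K] is replaced by [l], as in [mvfps_subst]: monomials outside [in_box l] have no
     coefficient of degree [l]. *)
  apply: le_trans (box_le_supp K m0 (l := l) _) _ => [p pl|].
    by rewrite mterm_out// mulr0.
  apply: le_box => p; apply: ler_wpM2l => //; apply: mterm_dominated.
  exact: leq_subr.
under eq_bigr do rewrite -boxZ.
rewrite -box_sum; apply: le_in_box => p pK; rewrite -horner_mterm.
rewrite (horner_coef_wide _ (szL p pK)) mulr_sumr.
by apply: ler_sum => l _; rewrite [leRHS]mulrCA [x ^+ l * _]mulrC.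
Qed.

End Solution.

(** * Characteristic points *)

Section StandardSolution.
Variables (R : realType) (m : nat) (G : 'I_m -> mvfps R m).
Hypothesis wcG : well_conditioned G.
Variable T : 'I_m -> nat -> R.
Hypothesis ssT : standard_solution G T.

Let G_ge0 i p : 0 <= G i p. Proof. exact: wc_ge0 wcG i p. Qed.
Let T_ge0 i n : 0 <= T i n. Proof. exact: ss_ge0 ssT i n. Qed.
Let T_at0 i : T i 0%N = 0. Proof. exact: ss_at0 ssT i. Qed.
Let T_fix i n : T i n = mvfps_subst (G i) T n.
Proof. exact: ss_fix ssT i n. Qed.

Lemma psum_mono x j : 0 <= x ->
  {homo (fun N => psum T N x 0 j) : M N / (M <= N)%N >-> M <= N}.
Proof.
by move=> x0 M N MN; rewrite !psum_pseries; exact: pseries_mono.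
Qed.

Lemma psumS_le_eval x N i : 0 <= x ->
  mvfps_converges (G i) x (psum T N x) ->
  psum T N.+1 x 0 i <= mvfps_eval (G i) x (psum T N x).
Proof.
move=> x0 cv; have y0 j := psum_ge0 T_ge0 N j x0.
have x0k k : G i (0%N, k) = 0 by exact: wc_x0.
apply: le_trans (psumS_le_box T_ge0 N (G_ge0 i) x0k (T_fix i) x0) _.
apply: box_le_ssum => [p|]; first exact: mvfps_term_ge0.
by move/convergesE : cv; exact.
Qed.

(** Induction on the order: each partial sum is at most [G] at the previous one, hence at most
    [G(x, b) <= b] by monotonicity. *)
Lemma psum_le_fix x (b : 'rV[R]_m) : 0 <= x -> (forall i, 0 <= b 0 i) ->
  (forall i, mvfps_converges (G i) x b) ->
  (forall i, mvfps_eval (G i) x b <= b 0 i) ->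
  forall N i, psum T N x 0 i <= b 0 i.
Proof.
move=> x0 b0 cv bfix; elim=> [|N IHN] i.
  by rewrite psumE big_ord1 T_at0 mul0r.
have y0 j := psum_ge0 T_ge0 N j x0.
have cvN := converges_le (G_ge0 i) x0 (lexx x) y0 IHN (cv i).
apply: le_trans (psumS_le_eval x0 cvN) _; apply: le_trans (bfix i).
exact: mvfps_eval_le.
Qed.

Section Limit.
Variables (x : R) (t : 'rV[R]_m).
Hypothesis x_ge0 : 0 <= x.
Hypothesis t_lim : forall i, pseries (T i) x @ \oo --> t 0 i.

Lemma pseries_le_lim N i : pseries (T i) x N <= t 0 i.
Proof.
rewrite -(cvg_lim _ (@t_lim i))//; apply: nondecreasing_cvgn_le.
  by move=> *; exact: pseries_mono.
by apply/cvg_ex; exists (t 0 i).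
Qed.

Lemma psum_le_lim N i : psum T N x 0 i <= t 0 i.
Proof. by rewrite psum_pseries pseries_le_lim. Qed.

Lemma lim_ge0 i : 0 <= t 0 i.
Proof. exact: le_trans (psum_ge0 T_ge0 0 i x_ge0) (psum_le_lim _ _). Qed.

Lemma psum_cvg i : psum T n x 0 i @[n --> \oo] --> t 0 i.
Proof.
rewrite (_ : (fun n => _) = [sequence pseries (T i) x n.+1]_n).
  by rewrite cvg_shiftS.
by apply/funext => n; rewrite psum_pseries.
Qed.

(** In [box_psum_le] let the order tend to infinity with the box fixed. The bound [t 0 i] does not
    depend on the box, which yields convergence and the inequality together. *)
Lemma lim_superfix i :
  mvfps_converges (G i) x t /\ mvfps_eval (G i) x t <= t 0 i.
Proof.
have t0 p : 0 <= mvfps_term (G i) x t p.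
  by apply: mvfps_term_ge0 => // j; exact: lim_ge0.
have tB K : box (mvfps_term (G i) x t) K <= t 0 i.
  apply: cvgr_to_le (@box_term_cvg _ _ (G i) x K _ _ psum_cvg) _.
  apply: nearW => n; have tN N := psum_le_lim N i.
  exact (box_psum_le T_ge0 T_at0 n K (G_ge0 i) (T_fix i) x_ge0 tN).
have [fs le] := bounded_finite_sum t0 tB.
by split=> //; apply/convergesE => // j; exact: lim_ge0.
Qed.

End Limit.
End StandardSolution.

Section CharacteristicPoint.
Variables (R : realType) (m : nat) (G : 'I_m -> mvfps R m).
Hypothesis m_gt0 : (0 < m)%N.
Hypothesis wcG : well_conditioned G.
Variable T : 'I_m -> nat -> R.
Hypothesis ssT : standard_solution G T.
Variables (rho : R) (tau : 'rV[R]_m).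
Hypothesis T_radius : forall i, radius_of_convergence (T i) = rho%:E.
Hypothesis T_tau : forall i, pseries (T i) rho @ \oo --> tau 0 i.
Variables (a : R) (b : 'rV[R]_m).
Hypothesis chab : characteristic_point G a b.

Let G_ge0 i p : 0 <= G i p. Proof. exact: wc_ge0 wcG i p. Qed.
Let T_ge0 i n : 0 <= T i n. Proof. exact: ss_ge0 ssT i n. Qed.
Let a_gt0 : 0 < a := cp_a_gt0 chab.
Let a_ge0 : 0 <= a := ltW a_gt0.
Let b_gt0 := cp_b_gt0 chab.
Let b_ge0 i : 0 <= b 0 i. Proof. exact/ltW/b_gt0. Qed.
Let G_cvg := cp_cvg chab.
Let dG_cvg := cp_dy_cvg chab.
Let b_fix := cp_fix chab.

Let J := jacobian_at G a b.
Let JE i j : J i j = mvfps_eval (mvfps_dy j (G i)) a b.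
Proof. by rewrite mxE. Qed.

Let dG_ge0 i j p : 0 <= mvfps_dy j (G i) p.
Proof. exact: mvfps_dy_ge0. Qed.

Lemma jacobian_ge0 i j : 0 <= J i j.
Proof. by rewrite JE mvfps_eval_ge0. Qed.

(** At a point with positive coordinates a nonzero series with nonnegative coefficients has a
    positive value, so every edge of the system is an edge of [J]. *)
Lemma jacobian_irreducible i j : connect (fun i j => 0 < J i j) i j.
Proof.
apply: connect_sub (wc_irr wcG i j) => k l /asboolP kl.
by apply: connect1; rewrite JE mvfps_eval_gt0.
Qed.

Lemma jacobian_eigenvalue1 : eigenvalue J 1.
Proof.
have /eqP/det0P[v vN v0] := cp_det chab.
apply/eigenvalueP; exists v => //; apply/eqP; rewrite scale1r eq_sym -subr_eq0.
by move: v0; rewrite mulmxBr mulmx1 => ->.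
Qed.

Lemma eigenvalues_has_sup : has_sup [set l | eigenvalue J l].
Proof.
split; first by exists 1; exact: jacobian_eigenvalue1.
by exists (\sum_j \sum_i J i j) => l; apply/eigenvalue_le/jacobian_ge0.
Qed.

Lemma exchange_dot (u d : 'I_m -> R) (B : 'I_m -> 'I_m -> R) :
  \sum_i u i * (\sum_j d j * B i j) = \sum_j d j * \sum_i u i * B i j.
Proof.
under eq_bigr do rewrite mulr_sumr.
rewrite exchange_big; apply: eq_bigr => j _.
by rewrite mulr_sumr; apply: eq_bigr => i _; rewrite mulrCA.
Qed.

(** A strict inequality in one coordinate would survive the pairing with a positive [u]. When
    [u J = u], the pairings of [d] and [J d] agree, and this applies to them. *)
Lemma left_eigenvector_eq (u : 'rV[R]_m) (d e : 'I_m -> R) :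
  (forall i, 0 < u 0 i) -> (forall i, d i <= e i) ->
  \sum_i u 0 i * d i = \sum_i u 0 i * e i -> forall i, d i = e i.
Proof.
move=> u0 de ude i; apply/eqP; rewrite eq_le de/= leNgt; apply/negP => lt.
suff : \sum_i u 0 i * d i < \sum_i u 0 i * e i by rewrite ude ltxx.
rewrite (bigD1 i)//= [ltRHS](bigD1 i)//= ltr_leD ?ltr_pM2l//.
by apply: ler_sum => j _; rewrite ler_pM2l.
Qed.

(** A nonzero coefficient of a second derivative comes from the monomial with the two differentiated
    variables multiplied back in. *)
Lemma nonlinear_monomial :
  exists i p, 0 < G i p /\ (1 < \sum_j p.2 j)%N.
Proof.
have [i [j [k [p pN]]]] := wc_nonlinear wcG.
exists i, (incr_exponent k (incr_exponent j p)); split.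
  rewrite lt0r G_ge0 andbT; apply: contra_neq pN.
  by rewrite /mvfps_dy /incr_exponent /= => ->; rewrite !mulr0.
under eq_bigr do rewrite /incr_exponent /= !ffunE.
rewrite !big_split /= [X in (_ + X + _)%N](bigD1 j)//= eqxx.
by rewrite [X in (_ + X)%N](bigD1 k)//= eqxx !add1n !addnS addSn.
Qed.

(** * Consequences of a positive left eigenvector for the eigenvalue 1 *)

Section LeftEigenvector.
Variables (u : 'rV[R]_m).
Hypothesis u_gt0 : forall i, 0 < u 0 i.
Hypothesis uJ : u *m J = u.

Let dotJ d : \sum_i u 0 i * (\sum_j d j * J i j) = \sum_i u 0 i * d i.
Proof.
rewrite exchange_dot; apply: eq_bigr => j _.
by have /rowP/(_ j) := uJ; rewrite mxE => ->; rewrite mulrC.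
Qed.

Lemma lim_eq_characteristic (t : 'rV[R]_m) :
  (forall i, pseries (T i) a @ \oo --> t 0 i) -> t = b.
Proof.
move=> t_lim; have t0 := lim_ge0 ssT a_ge0 t_lim.
have tb i : t 0 i <= b 0 i.
  apply: (cvgr_to_le (@psum_cvg _ _ _ _ _ t_lim i)); apply: nearW => N.
  by apply: (psum_le_fix wcG ssT) => // j; rewrite -b_fix.
have t_super i := (lim_superfix wcG ssT a_ge0 t_lim i).2.
pose d i := b 0 i - t 0 i.
have d0 i : 0 <= d i by rewrite subr_ge0.
have dJ i : d i <= \sum_j d j * J i j.
  rewrite lerBlDr addrC b_fix.
  apply: le_trans (mvfps_eval_tangent1 (G_ge0 i) a_ge0 t0 tb _ _) _ => //.
  under [X in _ <= _ + X]eq_bigr do rewrite JE.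
  by rewrite lerD2r.
have dJE := left_eigenvector_eq u_gt0 dJ (esym (dotJ d)).
(* If [d_k = 0], then the nonnegative sum [(J d)_k] vanishes, hence so does [d_l] for every [l] with
   [J k l > 0]. *)
have d_eq0 i : d i = 0 -> forall j, d j = 0.
  move=> di j; apply: (connect_invariant (P := fun i => d i = 0) _
    (jacobian_irreducible i j)) di => k l Jkl dk.
  have : \sum_j d j * J k j <= 0 by rewrite -dJE dk.
  rewrite (bigD1 l)//= => dJ0; apply/eqP; rewrite eq_le d0 andbT.
  rewrite -(pmulr_lle0 _ Jkl); apply: le_trans dJ0.
  rewrite lerDl sumr_ge0// => h _.
  by rewrite mulr_ge0 ?jacobian_ge0.
suff [i di] : exists i, d i = 0.
  apply/rowP => j; apply/eqP; rewrite eq_sym -subr_eq0.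
  exact/eqP/(d_eq0 i di).
apply: contrapT => /forallNP dN.
have [i [p [Gp p2]]] := nonlinear_monomial.
have tb_lt j : t 0 j < b 0 j.
  by rewrite lt_neqAle tb andbT eq_sym -subr_eq0; apply/eqP/dN.
have : b 0 i < mvfps_eval (G i) a t + \sum_j d j * J i j.
  under eq_bigr do rewrite JE.
  by rewrite b_fix; exact: mvfps_eval_tangent1_lt Gp p2.
by rewrite -dJE; move: (t_super i); rewrite /d; lra.
Qed.

Lemma characteristic_eq_extreme : a = rho /\ b = tau.
Proof.
have i0 : 'I_m by exact: Ordinal m_gt0.
pose t : 'rV[R]_m := \row_i limn (pseries (T i) a).
have t_cvg i : cvgn (pseries (T i) a).
  apply: nondecreasing_is_cvgn; first by move=> *; exact: pseries_mono.
  (* [psum] of order [n] is the partial sum with [n.+1] terms, so the empty sum is treated apart. *)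
  exists (b 0 i) => _ [[|n] _ <-].
    by rewrite /pseries seriesEord /= big_ord0.
  rewrite -psum_pseries; apply: (psum_le_fix wcG ssT) => // j.
  by rewrite -b_fix.
have t_lim i : pseries (T i) a @ \oo --> t 0 i by rewrite mxE.
have tb := lim_eq_characteristic t_lim; move: t_lim; rewrite tb => t_lim.
have : a <= rho.
  rewrite -lee_fin -(T_radius i0); apply: ereal_sup_ubound.
  by exists a => //; split.
rewrite le_eqVlt => /orP[/eqP a_rho|a_rho].
  split=> //; apply/rowP => i.
  by apply: cvg_unique (t_lim i) _ => //; rewrite a_rho; exact: T_tau.
exfalso; have rho0 := le_trans a_ge0 (ltW a_rho).
have b_tau i : b 0 i <= tau 0 i.
  apply: ler_cvg_to (t_lim i) (@T_tau i) _; apply: nearW => n.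
  rewrite /pseries !seriesEord; apply: ler_sum => k _; rewrite ler_wpM2l//.
  by rewrite lerXn2r ?nnegrE// ltW.
pose v i := tau 0 i - b 0 i.
(* Each [G i] contains a pure power of [x] with positive exponent; it grows strictly from [a] to
   [rho] and makes the tangent inequality strict. *)
have Jv i : \sum_j v j * J i j < v i.
  have [n Gn] := wc_y0 wcG i.
  have n0 : (0 < n)%N.
    by rewrite lt0n; apply: contra_neqN Gn => /eqP->; exact: wc_x0.
  have [cv super] := lim_superfix wcG ssT rho0 T_tau i.
  have Gn0 : 0 < G i (n, [ffun=> 0%N]) by rewrite lt0r Gn G_ge0.
  rewrite ltrBrDl; apply: lt_le_trans super.
  under eq_bigr do rewrite JE.
  rewrite b_fix; apply: mvfps_eval_tangent0_lt n0 Gn0 _ _ _ => //.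
  exact: ltW.
have := left_eigenvector_eq u_gt0 (fun i => ltW (Jv i)) (dotJ v) i0.
by apply/eqP; rewrite lt_eqF.
Qed.

End LeftEigenvector.

Lemma Lambda1_extreme : Lambda G a b = 1 -> a = rho /\ b = tau.
Proof.
move=> L1; have [l [u [l1 u0 uJ]]] :=
  perron_eigenvector jacobian_ge0 jacobian_irreducible jacobian_eigenvalue1.
have i0 : 'I_m by exact: Ordinal m_gt0.
have le1 : l <= 1.
  rewrite -L1; apply: (sup_upper_bound eigenvalues_has_sup) => /=.
  apply/eigenvalueP; exists u => //; apply/eqP => /rowP/(_ i0).
  by have := u0 i0; rewrite mxE => /[swap] ->; rewrite ltxx.
apply: (characteristic_eq_extreme u0); rewrite uJ.
by rewrite (@le_anti _ _ l 1) ?scale1r// le1.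
Qed.

(** If [T i] were a polynomial, its series would converge at every nonnegative real, against the
    finite radius [rho]. *)
Lemma T_infinite i N : exists2 n, (N <= n)%N & 0 < T i n.
Proof.
apply: contrapT => Tfin.
have T0 n : (N <= n)%N -> T i n = 0.
  move=> Nn; apply/eqP; rewrite eq_le T_ge0 andbT leNgt; apply/negP => Tn.
  by apply: Tfin; exists n.
have r_rho (r : R) : 0 <= r -> r <= rho.
  move=> r0; rewrite -lee_fin -(T_radius i); apply: ereal_sup_ubound.
  exists r => //; split=> //.
  apply: nondecreasing_is_cvgn; first by move=> *; exact: pseries_mono.
  exists (pseries (T i) r N) => _ [n _ <-].
  apply: le_trans (pseries_mono T_ge0 i r0 (leq_maxl n N)) _.
  rewrite -(subnKC (leq_maxr n N)) /pseries !seriesEord /= big_split_ord /=.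
  rewrite gerDl big1// => k _.
  by rewrite T0 ?mul0r// leq_addr.
(* [r_rho] at 0 gives [0 <= rho], so it may be applied to [rho + 1]. *)
have := r_rho (rho + 1); rewrite gerDl ler10 => /(_ _)/negP; apply=> //.
by rewrite addr_ge0// r_rho.
Qed.

Lemma Lambda_extreme : a = rho -> b = tau -> Lambda G a b = 1.
Proof.
move=> a_rho b_tau.
have T_lim i : pseries (T i) a @ \oo --> b 0 i by rewrite a_rho b_tau.
(* Since 1 is an eigenvalue of [J] by the determinant equation, only the upper bound on eigenvalues
   remains. *)
suff le1 l : eigenvalue J l -> l <= 1.
  apply/eqP; rewrite eq_le (sup_upper_bound eigenvalues_has_sup) ?andbT.
    by apply: ge_sup; [case: eigenvalues_has_sup|move=> l; exact: le1].
  exact: jacobian_eigenvalue1.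
move=> /(perron_eigenvector jacobian_ge0 jacobian_irreducible).
move=> [l' [u [ll' u0 uJ]]]; apply: le_trans ll' _.
rewrite leNgt; apply/negP => l1.
pose y n := psum T n a.
have y0 n j : 0 <= y n 0 j := psum_ge0 T_ge0 n j a_ge0.
have yb n j : y n 0 j <= b 0 j := psum_le_lim ssT a_ge0 T_lim n j.
have y_lim j : y n 0 j @[n --> \oo] --> b 0 j by exact: psum_cvg.
pose Jn n i j := mvfps_eval (mvfps_dy j (G i)) a (y n).
have Jn_cvg i j : Jn n i j @[n --> \oo] --> J i j.
  by rewrite JE; exact: mvfps_eval_cvg.
(* In the limit [(u J)_j = l' u_j > u_j]; finitely many strict inequalities hold together for large
   [n]. *)
have : \forall n \near \oo, forall j, u 0 j < \sum_i u 0 i * Jn n i j.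
  apply: filter_forall => j.
  have : \sum_i u 0 i * Jn n i j @[n --> \oo] --> \sum_i u 0 i * J i j.
    apply: cvg_big => [|i _]; first exact: add_continuous.
    by apply: cvgM; first exact: cvg_cst.
  move=> /cvgr_gt; apply.
  have /rowP/(_ j) := uJ; rewrite !mxE => ->.
  by rewrite ltr_pMl.
move=> [n _ /(_ n (leqnn n))/= un].
pose v j := b 0 j - y n 0 j.
have v0 j : 0 < v j.
  rewrite subr_gt0; have [k nk Tk] := T_infinite j n.+1.
  apply: lt_le_trans (psum_le_lim ssT a_ge0 T_lim k j).
  case: k nk Tk => // k; rewrite ltnS => nk Tk.
  apply: le_lt_trans (psum_mono ssT j a_ge0 nk) _.
  rewrite !psumE [ltRHS]big_ord_recr /= ltrDl.
  by rewrite mulr_gt0 ?exprn_gt0.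
(* The tangent at [y n] towards [b] bounds the left side by [b - G(a, y n)], and [y n] is at most
   the next partial sum, hence at most [G(a, y n)]. *)
have Jv i : \sum_j v j * Jn n i j <= v i.
  have cv := converges_le (G_ge0 i) a_ge0 (lexx a) (y0 n) (yb n) (G_cvg i).
  have cdv j :=
    converges_le (dG_ge0 i j) a_ge0 (lexx a) (y0 n) (yb n) (dG_cvg i j).
  have := mvfps_eval_tangent0 (G_ge0 i) a_ge0 (lexx a) (y0 n) (yb n)
    (G_cvg i) cdv.
  rewrite -b_fix -lerBrDl => /le_trans; apply; rewrite lerB//.
  apply: le_trans (psumS_le_eval wcG ssT a_ge0 cv).
  exact (psum_mono ssT i a_ge0 (leqnSn n)).
have : \sum_i u 0 i * (\sum_j v j * Jn n i j) <= \sum_i u 0 i * v i.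
  by apply: ler_sum => i _; rewrite ler_pM2l.
(* After the exchange, [v > 0] is paired with [u Jn], which exceeds [u] in every coordinate, so the
   pairing strictly exceeds that of [u] with [v]. *)
rewrite exchange_dot leNgt => /negP; apply.
have i0 : 'I_m by exact: Ordinal m_gt0.
rewrite (bigD1 i0)//= [ltRHS](bigD1 i0)//= [u 0 i0 * _]mulrC.
rewrite ltr_leD ?ltr_pM2l// ler_sum// => j _.
by rewrite mulrC ler_pM2l// ltW.
Qed.

End CharacteristicPoint.

Theorem proposition19 (R : realType) (m : nat) (hm : (1 <= m)%N)
    (G : 'I_m -> mvfps R m) (hG : well_conditioned G)
    (rho : R) (tau : 'rV[R]_m) (hext : extreme_point G rho tau)
    (a : R) (b : 'rV[R]_m) (hchar : characteristic_point G a b) :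
  Lambda G a b = 1 <-> (a, b) = (rho, tau).
Proof.
have [T [ssT T_ext]] := hext.
have T_radius i := (T_ext i).1; have T_tau i := (T_ext i).2.
split=> [/(Lambda1_extreme hm hG ssT T_radius T_tau hchar)[-> ->]//|[]].
exact: (Lambda_extreme hm hG ssT T_radius T_tau hchar).
Qed.
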